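(* Let $q$ be an odd prime power, let $d$ be odd, let $i \in \{3,4\}$, let $n,m$ be positive integers and let $r \in \mathbb{F}_q^\times$. Define \[I^\Delta_r(n,m) = \max\left|I(P,S) - q^{-1}|P|\,|S|\right|,\] where the maximum is over all $P \subseteq \mathbb{F}_q^d$ with $|P| = n$ and all sets $S$ of $Q_i^d$-spheres each of radius $r$ with $|S| = m$. Then \[I^\Delta_r(n,m) < 3\,q^{(d-1)/2}m^{1/2}n^{1/2}.\]
   Context: $\mathbb{F}_q$ is the finite field with $q$ elements and $\mathbb{F}_q^\times=\mathbb{F}_q\setminus\{0\}$. Fix a non-square $\epsilon\in\mathbb{F}_q$. For odd $d$, define quadratic forms on $\mathbb{F}_q^d$ by $Q_3^d(x) = x_1x_2 + x_3x_4 + \cdots + x_{d-2}x_{d-1} - x_d^2$ and $Q_4^d(x) = x_1x_2 + x_3x_4 + \cdots + x_{d-2}x_{d-1} - \epsilon x_d^2$. For a quadratic form $Q$, the $Q$-sphere with center $y$ and radius $r$ is $\{x \in \mathbb{F}_q^d : Q(x-y) = r\}$; a sphere is specified by its center and radius. For $P \subseteq \mathbb{F}_q^d$ and a set $S$ of spheres, $I(P,S) = \#\{(x,s) \in P \times S : x \in s\}$. *)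

(* Defs.v *)
From HB Require Import structures.
From mathcomp Require Import all_boot all_order all_algebra.

Set Implicit Arguments.
Unset Strict Implicit.
Unset Printing Implicit Defensive.

Import Order.TTheory GRing.Theory Num.Theory.
Local Open Scope ring_scope.

Section Spheres.

Variables (F : finFieldType) (d : nat).

(* The k-th coordinate of x, counted from 0 (so x_1 is [coord x 0]); the
   default value 0 for k >= d is never used below when d is odd. *)
Definition coord (x : 'rV[F]_d) (k : nat) : F :=
  if insub k is Some j then x 0 j else 0.

(* x_1 x_2 + x_3 x_4 + ... + x_{d-2} x_{d-1}, for d odd *)
Definition hyperbolic_part (x : 'rV[F]_d) : F :=
  \sum_(j < d./2) coord x j.*2 * coord x j.*2.+1.

Definition Q3 (x : 'rV[F]_d) : F :=
  hyperbolic_part x - coord x d.-1 ^+ 2.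

Definition Q4 (eps : F) (x : 'rV[F]_d) : F :=
  hyperbolic_part x - eps * coord x d.-1 ^+ 2.

(* Only the indices 3 and 4 are meaningful. *)
Definition Qform (eps : F) (i : nat) : 'rV[F]_d -> F :=
  match i with
  | 3 => Q3
  | 4 => Q4 eps
  | _ => fun=> 0
  end.

(* A sphere is the pair (center, radius), not its set of points. *)
Definition sphere : finType := ('rV[F]_d * F)%type.
Definition center (s : sphere) : 'rV[F]_d := s.1.
Definition radius (s : sphere) : F := s.2.

Definition sphere_points (Q : 'rV[F]_d -> F) (s : sphere) : {set 'rV[F]_d} :=
  [set x | Q (x - center s) == radius s].

Definition incidences (Q : 'rV[F]_d -> F)
    (P : {set 'rV[F]_d}) (S : {set sphere}) : nat :=
  #|[set xs in setX P S | xs.1 \in sphere_points Q xs.2]|.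

(* The maximum is of nonnegative quantities, so the unit 0 does not affect it;
   it is 0 when no P or no S has the required size. *)
Definition max_discrepancy (R : rcfType) (Q : 'rV[F]_d -> F)
    (r : F) (n m : nat) : R :=
  \big[Num.max/0]_(P : {set 'rV[F]_d} | #|P| == n)
    \big[Num.max/0]_(S : {set sphere} |
                      (#|S| == m) && [forall s in S, radius s == r])
      `|(incidences Q P S)%:R - #|F|%:R^-1 * #|P|%:R * #|S|%:R|.

End Spheres.

(* Main.v *)
(* Writing M(v) = [Q v = r] - 1/q, the discrepancy is the bilinear form
   sum_(x in P, y in C) M(x - y), C being the set of centers, so by Plancherel
   and Cauchy-Schwarz it is at most max |M^| * sqrt (|P| |C|).  Expanding M in
   additive characters psi of F_q and summing out the hyperbolic planes of Q
   leaves M^(xi) = q^((d-1)/2) * (1/q) * T with T the Salie sum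
     T = sum_(t <> 0, z) psi(- r t - b t z^2 - c / t),
   c depending on xi.  If c = - b a^2, the shift z -> z + a / t removes the
   term in 1 / t and gives |T| <= 2 q; otherwise replacing b by b nu, nu a
   nonsquare, only changes the sign of T and makes c of that form. *)

Require Import Defs.
From HB Require Import structures.
From mathcomp Require Import all_boot all_order all_algebra.
From mathcomp Require Import all_fingroup all_solvable all_field all_character.
From mathcomp Require Import ring.

Set Implicit Arguments.
Unset Strict Implicit.
Unset Printing Implicit Defensive.

Import Order.TTheory GRing.Theory Num.Theory.
(* [coord] and [center] also name notions of linear algebra and group theory. *)
Import Defs.
Local Open Scope ring_scope.

(** * Preliminaries: additive characters, Cauchy-Schwarz, odd characteristic *)

Lemma exists_nontrivial_additive_char (F : finFieldType) :
  exists psi : F -> algC,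
    [/\ {morph psi : x y / x + y >-> x * y}, forall x, `|psi x| = 1
      & exists a, psi a != 1].
Proof.
pose G := [set: F]%G.
have abG : abelian G by apply/centsP => x _ y _; apply: addrC.
have lt1N : (1 < Nirr G)%N.
  move: (card_Iirr_abelian abG); rewrite card_ord => ->.
  by rewrite cardsT; apply: finNzRing_gt1.
have [i nz_i] : exists i : Iirr G, i != 0.
  exists (Ordinal lt1N : 'I_(Nirr G)); by apply/eqP=> /(congr1 val).
have lin_i : 'chi_i \is a linear_char by apply/char_abelianP.
exists (fun x => 'chi_i x); split.
- by move=> x y; apply: (lin_charM lin_i); rewrite inE.
- by move=> x; apply: (normC_lin_char lin_i); rewrite inE.
(* A character equal to 1 everywhere is the trivial one, of index 0. *)
apply/existsP; apply: contraR nz_i => /existsPn eq1.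
apply/eqP/irr_inj/cfunP => x; rewrite irr0 cfun1E inE.
by apply/eqP; rewrite -[_ == _]negbK eq1.
Qed.

Lemma sqr_sum_mul_le (R : numDomainType) (I : finType) (a b : I -> R) :
    (forall i, a i \is Num.real) -> (forall i, b i \is Num.real) ->
  (\sum_i a i * b i) ^+ 2 <= (\sum_i a i ^+ 2) * (\sum_i b i ^+ 2).
Proof.
(* Doubling lets the sum of squares below run over all ordered pairs. *)
move=> Ra Rb; rewrite -(ler_pMn2r (_ : 0 < 2)%N) // -subr_ge0.
(* Lagrange's identity *)
suff -> : (\sum_i a i ^+ 2) * (\sum_i b i ^+ 2) *+ 2
            - (\sum_i a i * b i) ^+ 2 *+ 2
          = \sum_i \sum_j (a i * b j - a j * b i) ^+ 2.
  do 2!apply: sumr_ge0 => ? _; apply: real_exprn_even_ge0 => //.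
  by rewrite rpredB ?rpredM.
have dist (f g : I -> R) :
    (\sum_i f i) * (\sum_i g i) = \sum_i \sum_j f i * g j.
  by rewrite mulr_suml; apply: eq_bigr => i _; rewrite mulr_sumr.
rewrite mulr2n {2}[_ * _]mulrC expr2 !dist -sumrMnl -big_split -sumrB /=.
apply: eq_bigr => i _; rewrite -sumrMnl -big_split -sumrB /=.
by apply: eq_bigr => j _; ring.
Qed.

(** The order of the additive group annihilates 1, so [q = 0] in [F]; if also [2 = 0], an odd [q]
    would equal 1. *)
Lemma two_neq0 (F : finFieldType) : odd #|F| -> 2%:R != 0 :> F.
Proof.
move=> q_odd.
have q0 : #|F|%:R = 0 :> F.
  by rewrite -cardsT -FinRing.Theory.zmodXgE expg_cardG ?inE.
apply/eqP=> two0; move/eqP: q0; rewrite -[#|F|]odd_double_half q_odd.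
by rewrite -muln2 natrD natrM two0 mulr0 addr0 oner_eq0.
Qed.

(** * Squares and nonsquare multiples of squares *)

Section TwistedSquares.
Variables (F : finFieldType) (nu : F).
Hypothesis nonsq : forall a : F, a ^+ 2 != nu.

Lemma card_sqrts_twisted_sqrts (y : F) :
  (#|[set z : F | (z ^+ 2)%R == y]|
     + #|[set z : F | (nu * z ^+ 2)%R == y]| = 2)%N.
Proof.
have nu0 : nu != 0 by have := nonsq 0; rewrite expr0n eq_sym.
pose A x := [set z : F | z ^+ 2 == x].
pose B x := [set z : F | nu * z ^+ 2 == x].
have leA x : (#|A x| <= 2)%N.
  case: (set_0Vmem (A x)) => [->|[z]]; first by rewrite cards0.
  rewrite inE => /eqP zx; apply: leq_trans (_ : #|[set z; - z]| <= 2)%N.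
    by apply/subset_leq_card/subsetP=> w; rewrite !inE -zx eqf_sqr.
  by rewrite cards2; case: eqP.
have leB x : (#|B x| <= 2)%N.
  suff -> : B x = A (nu^-1 * x) by [].
  by apply/setP=> z; rewrite !inE -(inj_eq (mulfI nu0) _ (nu^-1 * x)) mulVKf.
(* At most two solutions for each x and two on average, so always exactly two. *)
have leAB x : (#|A x| + #|B x| <= 2)%N.
  case: (set_0Vmem (A x)) => [->|[z]]; first by rewrite cards0 add0n leB.
  case: (set_0Vmem (B x)) => [->|[w]]; first by rewrite cards0 addn0 leA.
  rewrite !inE => /eqP wx /eqP zx.
  (* From [z ^+ 2 = nu * w ^+ 2] with [w != 0], [nu] would be the square of [z / w]; so both sets
     are inhabited only at [x = 0]. *)
  have [w0|w0] := eqVneq w 0; last first.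
    have /eqP[] := nonsq (z / w); rewrite expr_div_n zx -wx.
    by rewrite mulfK // expf_neq0.
  have x0 : x = 0 by rewrite -wx w0 expr0n mulr0.
  have -> : A x = [set 0] by apply/setP=> t; rewrite !inE x0 sqrf_eq0.
  have -> : B x = [set 0].
    by apply/setP=> t; rewrite !inE x0 mulf_eq0 (negPf nu0) sqrf_eq0.
  by rewrite cards1.
have part (h : F -> F) : (\sum_x #|[set z | h z == x]| = #|F|)%N.
  rewrite -[RHS]sum1_card [RHS](partition_big h predT) //=.
  apply: eq_bigr => x _.
  by rewrite -sum1dep_card; apply: eq_bigl => z.
have /leqif_sum[_] : forall x, true ->
    (#|A x| + #|B x| <= 2 ?= iff (#|A x| + #|B x| == 2))%N.
  by move=> x _; split.
rewrite big_split /= !part sum_nat_const muln2 addnn eqxx.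
by move=> /esym/forallP/(_ y)/eqP.
Qed.

Lemma sqr_or_twisted_sqr (y : F) :
  (exists z, y = z ^+ 2) \/ exists z, y = nu * z ^+ 2.
Proof.
have := card_sqrts_twisted_sqrts y.
case: (set_0Vmem [set z | z ^+ 2 == y]) => [->|[z]]; last first.
  by rewrite inE => /eqP<- _; left; exists z.
case: (set_0Vmem [set z | nu * z ^+ 2 == y]) => [->|[z]]; last first.
  by rewrite inE => /eqP<- _; right; exists z.
by rewrite cards0.
Qed.

(** Together, [z ^+ 2] and [nu * z ^+ 2] take each value exactly twice. *)
Lemma sum_sqrD_twisted_sqr (f : F -> algC) :
  \sum_z f (z ^+ 2) + \sum_z f (nu * z ^+ 2) = (\sum_y f y) *+ 2.
Proof.
have part (h : F -> F) :
    \sum_z f (h z) = \sum_y f y *+ #|[set z | h z == y]|.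
  rewrite (partition_big h predT) //=; apply: eq_bigr => y _.
  rewrite (eq_bigr (fun=> f y)) => [|z /eqP-> //].
  by rewrite sumr_const cardsE.
rewrite (part (fun z => z ^+ 2)) (part (fun z => nu * z ^+ 2)) -big_split /=.
rewrite -sumrMnl; apply: eq_bigr => y _.
by rewrite -mulrnDr card_sqrts_twisted_sqrts.
Qed.

End TwistedSquares.

(** * Plancherel bound for difference kernels *)

(** The [e xi] act as characters and [c] as the Fourier coefficients of [M]. The kernel separates
    into transforms of [P] and [S], whose squared norms are [N * #|P|] and [N * #|S|];
    Cauchy-Schwarz concludes. Squaring avoids roots. *)
Lemma norm_difference_kernel_sum (Xi : finType) (V : zmodType) (N : nat)
    (e : Xi -> V -> algC) (c : Xi -> algC) (M : V -> algC) (B : algC)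
    (I J : finType) (P : {set I}) (S : {set J}) (f : I -> V) (g : J -> V) :
    (forall xi x y, e xi (x - y) = e xi x * (e xi y)^*) ->
    (forall v, \sum_xi e xi v = N%:R *+ (v == 0)) ->
    (forall v, M v = \sum_xi c xi * e xi v) ->
    0 <= B -> (forall xi, `|c xi| <= B) ->
    {in P &, injective f} -> {in S &, injective g} ->
  `|\sum_(i in P) \sum_(j in S) M (f i - g j)| ^+ 2
     <= (B * N%:R) ^+ 2 * #|P|%:R * #|S|%:R.
Proof.
move=> eB orth defM B_ge0 le_cB inj_f inj_g.
have parseval (K : finType) (A : {set K}) (h : K -> V) :
    {in A &, injective h} ->
    \sum_xi `|\sum_(i in A) e xi (h i)| ^+ 2 = N%:R * #|A|%:R.
  move=> inj_h.
  transitivity (\sum_(i in A) \sum_(j in A) \sum_xi e xi (h i - h j)).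
    under [RHS]eq_bigr do rewrite exchange_big /=.
    rewrite [RHS]exchange_big /=; apply: eq_bigr => xi _.
    rewrite normCK rmorph_sum mulr_suml; apply: eq_bigr => i _.
    by rewrite mulr_sumr; apply: eq_bigr => j _; rewrite eB.
  (* By orthogonality and injectivity of [h], only [j = i] contributes. *)
  rewrite mulr_natr -sumr_const; apply: eq_bigr => i Ai.
  rewrite (bigD1 i) //= orth subrr eqxx big1 ?addr0 // => j /andP[Aj /negPf ji].
  by rewrite orth subr_eq0 (inj_in_eq inj_h) // eq_sym ji mulr0n.
pose fhat xi := \sum_(i in P) e xi (f i).
pose ghat xi := \sum_(j in S) e xi (g j).
have -> : \sum_(i in P) \sum_(j in S) M (f i - g j)
    = \sum_xi c xi * (fhat xi * (ghat xi)^*).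
  under [RHS]eq_bigr do rewrite /fhat mulr_suml mulr_sumr.
  rewrite [RHS]exchange_big /=; apply: eq_bigr => i _.
  under eq_bigr do rewrite defM.
  rewrite exchange_big /=; apply: eq_bigr => xi _.
  rewrite /ghat rmorph_sum !mulr_sumr; apply: eq_bigr => j _.
  by rewrite eB.
apply: (@le_trans _ _ ((B * \sum_xi `|fhat xi| * `|ghat xi|) ^+ 2)).
  rewrite ler_pXn2r ?nnegrE ?mulr_ge0 ?sumr_ge0 // => [|xi _]; last first.
    by rewrite mulr_ge0.
  apply: le_trans (ler_norm_sum _ _ _) _; rewrite mulr_sumr.
  apply: ler_sum => xi _; rewrite !normrM norm_conjC.
  by rewrite ler_wpM2r ?mulr_ge0.
rewrite !exprMn -!(mulrA (B ^+ 2)) ler_wpM2l ?exprn_ge0 //.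
have := @sqr_sum_mul_le _ _ (fun xi => `|fhat xi|) (fun xi => `|ghat xi|).
move=> /(_ (fun=> normr_real _) (fun=> normr_real _)) /le_trans; apply.
by rewrite /fhat /ghat !parseval // expr2 -!mulrA [#|P|%:R * (N%:R * _)]mulrCA.
Qed.

(** * Sums of a nontrivial additive character, Salie sums *)

Section AdditiveCharacter.
Variables (F : finFieldType) (psi : F -> algC).
Hypotheses (psiD : {morph psi : x y / x + y >-> x * y})
  (norm_psi : forall x, `|psi x| = 1) (psi_nontriv : exists a, psi a != 1).

Local Notation q := (#|F|%:R : algC).

Lemma psi_neq0 x : psi x != 0.
Proof. by rewrite -normr_eq0 norm_psi oner_eq0. Qed.

Lemma psi0 : psi 0 = 1.
Proof. by apply: (mulfI (psi_neq0 0)); rewrite -psiD addr0 mulr1. Qed.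

Lemma psiN x : psi (- x) = (psi x)^*.
Proof.
apply: (mulfI (psi_neq0 x)).
by rewrite -psiD subrr psi0 -normCK norm_psi expr1n.
Qed.

Lemma psi_sum (I : finType) (f : I -> F) :
  psi (\sum_i f i) = \prod_i psi (f i).
Proof. exact: (big_morph psi psiD psi0). Qed.

Lemma sum_psi : \sum_x psi x = 0.
Proof.
have [a psia] := psi_nontriv; apply: (mulfI (_ : psi a - 1 != 0)).
  by rewrite subr_eq0.
rewrite mulr0 mulrBl mul1r mulr_sumr; apply/eqP; rewrite subr_eq0; apply/eqP.
rewrite [RHS](reindex_inj (addrI a)) /=.
by apply: eq_bigr => x _; rewrite psiD.
Qed.

Lemma sum_psiM (c : F) : \sum_x psi (c * x) = q *+ (c == 0).
Proof.
have [->|c0] := eqVneq c 0.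
  rewrite (eq_bigr (fun=> 1)) => [|x _]; last by rewrite mul0r psi0.
  by rewrite sumr_const cardT -cardE.
by rewrite -[RHS]sum_psi [RHS](reindex_inj (mulfI c0)).
Qed.

Lemma sum_neq0 (f : F -> algC) : \sum_(t | t != 0) f t = \sum_t f t - f 0.
Proof. by rewrite [in RHS](bigD1 0) //= addrAC subrr add0r. Qed.

(* For b != 0 the inner sum over z is a Gauss sum, so this is a Salie sum up to
   normalization. *)
Definition salie (r b c : F) : algC :=
  \sum_(t | t != 0) \sum_z psi (- (r * t) - b * t * z ^+ 2 - c / t).

(** After the shift by [a / t] the exponent is affine in [t], so summing over [t] leaves [q] at each
    of the at most two roots of [r + b * y ^+ 2], minus the contribution of [t = 0]. *)
Lemma norm_salie_sqr r b a : 2%:R != 0 :> F -> b != 0 ->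
  `|salie r b (- (b * a ^+ 2))| <= 2%:R * q.
Proof.
move=> two0 b0.
pose y0 y := r + b * y ^+ 2 == 0.
have -> : salie r b (- (b * a ^+ 2))
    = q * (\sum_(y | y0 y) psi (- (2%:R * b * a) * y)) - q *+ (a == 0).
  transitivity (\sum_y psi (- (2%:R * b * a) * y) *
      \sum_(t | t != 0) psi (- (r + b * y ^+ 2) * t)).
    rewrite /salie (eq_bigr (fun t => \sum_y psi (- (2%:R * b * a) * y)
        * psi (- (r + b * y ^+ 2) * t))) => [|t t0].
      by rewrite exchange_big /=; apply: eq_bigr => y _; rewrite mulr_sumr.
    rewrite (reindex_inj (addIr (a / t))) /=; apply: eq_bigr => y _.
    by rewrite -psiD; congr (psi _); field.
  under eq_bigr do rewrite sum_neq0 mulr0 psi0 sum_psiM mulrBr mulr1.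
  rewrite sumrB sum_psiM oppr_eq0 !mulf_eq0 (negPf two0) (negPf b0) /=.
  congr (_ - _); rewrite mulr_sumr [RHS]big_mkcond /=; apply: eq_bigr => y _.
  by rewrite oppr_eq0 -/(y0 y); case: (y0 y); rewrite ?mulr0 // mulrC.
have card_y0 : (#|[pred y | y0 y]| <= 2)%N.
  case: (pickP y0) => [z z0|none]; last by rewrite eq_card0.
  apply: leq_trans (_ : #|pred2 z (- z)| <= 2)%N; last first.
    by rewrite card2; case: eqP.
  apply/subset_leq_card/subsetP=> w; rewrite !inE => w0; rewrite -eqf_sqr.
  by rewrite -(inj_eq (mulfI b0)) -(inj_eq (addrI r)) (eqP w0) eq_sym.
(* For [a = 0] the triangle inequality would only give [3 q]; but then every term is 1 and the sum
   is [q] times the number of roots minus 1. *)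
have [->|a0] := eqVneq a 0; last first.
  rewrite subr0 normrM normr_nat mulrC ler_wpM2r ?ler0n //.
  apply: le_trans (ler_norm_sum _ _ _) _.
  under eq_bigr do rewrite norm_psi.
  by rewrite sumr_const ler_nat.
under eq_bigr do rewrite mulr0 oppr0 mul0r psi0.
rewrite sumr_const -[q *+ true]mulr1 -mulrBr normrM normr_nat mulrC.
rewrite ler_wpM2r ?ler0n //.
move: card_y0; case: #|_| => [|[|[|//]]] _;
  rewrite ?sub0r ?normrN ?normr1 ?ler1n //.
  by rewrite subrr normr0 ler0n.
by rewrite mulr2n addrK normr1 lerDl ler01.
Qed.

(* The two inner Gauss sums add up to twice a complete character sum, which
   vanishes. *)
Lemma salie_twist nu r b c : (forall a : F, a ^+ 2 != nu) ->
  b != 0 -> salie r (b * nu) c = - salie r b c.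
Proof.
move=> nonsq b0; apply/eqP; rewrite -addr_eq0 /salie -big_split /=.
apply/eqP/big1 => t t0.
pose u := psi (- (r * t) - c / t).
have gauss k : \sum_z psi (- (r * t) - k * t * z ^+ 2 - c / t)
    = u * \sum_z psi (- (k * t) * z ^+ 2).
  rewrite mulr_sumr; apply: eq_bigr => z _; rewrite /u -psiD.
  by congr (psi _); ring.
rewrite !gauss -mulrDr addrC.
under [X in _ + X]eq_bigr do rewrite [b * nu * t]mulrAC -mulNr -mulrA.
rewrite (sum_sqrD_twisted_sqr nonsq (fun y => psi (- (b * t) * y))).
by rewrite sum_psiM oppr_eq0 mulf_eq0 (negPf b0) (negPf t0) mul0rn mulr0.
Qed.

Lemma norm_salie nu r b c : odd #|F| -> (forall a : F, a ^+ 2 != nu) ->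
  b != 0 -> `|salie r b c| <= 2%:R * q.
Proof.
move=> q_odd nonsq b0; have two0 := two_neq0 q_odd.
have [[a]|[a]] := sqr_or_twisted_sqr nonsq (- (c / b)) => def_a.
  have -> : c = - (b * a ^+ 2) by rewrite -def_a; field.
  exact: norm_salie_sqr.
have nu0 : nu != 0 by have := nonsq 0; rewrite expr0n eq_sym.
rewrite -normrN -(salie_twist _ _ nonsq b0).
have -> : c = - (b * nu * a ^+ 2) by rewrite -mulrA -def_a; field.
by apply: norm_salie_sqr; rewrite ?mulf_neq0.
Qed.

(** * Fourier analysis on [F ^ (2k + 1)], encoded as [k] hyperbolic pairs and a last coordinate so
    that sums factor *)

Local Notation W k := ({ffun 'I_k -> F * F} * F)%type.

Lemma sum_prod_split k (phi : 'I_k -> F * F -> algC) (chi : F -> algC) :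
  \sum_(w : W k) (\prod_j phi j (w.1 j)) * chi w.2
  = (\prod_j \sum_p phi j p) * \sum_z chi z.
Proof.
rewrite bigA_distr_bigA mulr_suml /=.
under [RHS]eq_bigr do rewrite mulr_sumr.
by rewrite pair_bigA.
Qed.

Definition dotW k (xi w : W k) : F :=
  \sum_j ((xi.1 j).1 * (w.1 j).1 + (xi.1 j).2 * (w.1 j).2) + xi.2 * w.2.

Definition QW k (b : F) (w : W k) : F :=
  \sum_j (w.1 j).1 * (w.1 j).2 - b * w.2 ^+ 2.

(* The dual quadratic form of [QW b], with [- QW_dual b xi / t] the critical
   value of [t * QW b - dotW xi]. *)
Definition QW_dual k (b : F) (xi : W k) : F :=
  \sum_j (xi.1 j).1 * (xi.1 j).2 - xi.2 ^+ 2 / (2%:R ^+ 2 * b).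

Lemma dotWD k (xi x y : W k) : dotW xi (x + y) = dotW xi x + dotW xi y.
Proof.
rewrite /dotW addrACA -big_split /= mulrDr; congr (_ + _).
by apply: eq_bigr => j _; rewrite ffunE /=; ring.
Qed.

Lemma dotWN k (xi x : W k) : dotW xi (- x) = - dotW xi x.
Proof.
rewrite /dotW opprD -sumrN /= mulrN; congr (_ + _).
by apply: eq_bigr => j _; rewrite ffunE /=; ring.
Qed.

Lemma sum_pair (f g : F -> algC) :
  \sum_(p : F * F) f p.1 * g p.2 = (\sum_x f x) * \sum_y g y.
Proof.
by rewrite -(pair_bigA _ (fun x y => f x * g y)) /= mulr_suml;
  apply: eq_bigr => x _; rewrite mulr_sumr.
Qed.

Lemma sum_psi_dotW k (v : W k) :
  \sum_xi psi (dotW xi v) = #|{: W k}|%:R *+ (v == 0).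
Proof.
have [->|v0] := eqVneq v 0.
  have dot0 (xi : W k) : dotW xi 0 = 0.
    by apply: (addrI (dotW xi 0)); rewrite -dotWD !addr0.
  under eq_bigr do rewrite dot0 psi0.
  by rewrite sumr_const cardT -cardE.
under eq_bigr do rewrite psiD psi_sum.
rewrite (sum_prod_split
  (fun j p => psi (p.1 * (v.1 j).1 + p.2 * (v.1 j).2))
  (fun z => psi (z * v.2))).
under eq_bigr => j _.
  under eq_bigr do rewrite psiD [_.1 * _]mulrC [_.2 * _]mulrC.
  rewrite (sum_pair (fun x => psi ((v.1 j).1 * x))
                    (fun x => psi ((v.1 j).2 * x))) !sum_psiM.
  over.
under [X in _ * X]eq_bigr do rewrite mulrC.
rewrite sum_psiM; apply/eqP; rewrite mulf_eq0; apply/orP.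
have [v2|v2] := eqVneq v.2 0; last by right; rewrite mulr0n.
(* A nonzero coordinate of [v] makes its factor vanish. *)
left; apply/prodf_eq0; apply/exists_inP; apply: contraR v0 => /exists_inPn none.
apply/eqP; case: v v2 none => v1 v2 /= -> none; congr (_, _).
apply/ffunP=> j; rewrite ffunE; have := none j isT.
case: (v1 j) => x y /=.
case: (eqVneq x 0) => [->|_]; last by rewrite mul0r eqxx.
by case: (eqVneq y 0) => [->|_]; rewrite ?mulr0 ?eqxx.
Qed.

(** The exponent is affine in [p.2] with slope [t * p.1 - y], so summing over [p.2] forces
    [p.1 = y / t]. *)
Lemma sum_psi_hyperbolic (t x y : F) : t != 0 ->
  \sum_(p : F * F) psi (t * (p.1 * p.2) - (x * p.1 + y * p.2))
  = q * psi (- (x * y) / t).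
Proof.
move=> t0.
rewrite -(pair_bigA _ (fun u v => psi (t * (u * v) - (x * u + y * v)))) /=.
transitivity (\sum_u psi (- (x * u)) * (q *+ (u == y / t))).
  apply: eq_bigr => u _.
  have -> : (u == y / t) = (t * u - y == 0).
    by rewrite subr_eq0 -(inj_eq (mulfI t0)) mulrCA divff // mulr1.
  rewrite -sum_psiM mulr_sumr; apply: eq_bigr => v _; rewrite -psiD.
  by congr (psi _); ring.
rewrite (bigD1 (y / t)) //= eqxx big1 => [|u /negPf->]; last first.
  by rewrite mulr0n mulr0.
by rewrite addr0 mulrC mulrA mulNr.
Qed.

Lemma sum_psi_QW k (b r t : F) (xi : W k) :
  2%:R != 0 :> F -> b != 0 -> t != 0 ->
  \sum_w psi (t * (QW b w - r) - dotW xi w)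
  = q ^+ k * \sum_z psi (- (r * t) - b * t * z ^+ 2 - QW_dual b xi / t).
Proof.
move=> two0 b0 t0.
transitivity (\sum_(w : W k)
    (\prod_j psi (t * ((w.1 j).1 * (w.1 j).2)
                  - ((xi.1 j).1 * (w.1 j).1 + (xi.1 j).2 * (w.1 j).2)))
    * psi (- (r * t) - b * t * w.2 ^+ 2 - xi.2 * w.2)).
  apply: eq_bigr => w _; rewrite -psi_sum -psiD sumrB -mulr_sumr /QW /dotW.
  by congr (psi _); ring.
rewrite (sum_prod_split
  (fun j p => psi (t * (p.1 * p.2) - ((xi.1 j).1 * p.1 + (xi.1 j).2 * p.2)))
  (fun z => psi (- (r * t) - b * t * z ^+ 2 - xi.2 * z))).
under eq_bigr do rewrite sum_psi_hyperbolic //.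
rewrite big_split /= prodr_const card_ord -psi_sum -mulrA; congr (_ * _).
(* This shift completes the square in the last coordinate. *)
rewrite (reindex_inj (addIr (- (xi.2 / (2%:R * b * t))))) mulr_sumr /=.
apply: eq_bigr => z _; rewrite -psiD -mulr_suml sumrN /QW_dual.
have four0 : 4%:R != 0 :> F by rewrite (natrM _ 2 2) mulf_neq0.
by congr (psi _); field; rewrite t0 b0 four0 two0.
Qed.

Lemma sphere_kernel_fourier k (b r : F) : 2%:R != 0 :> F -> b != 0 ->
  forall w : W k, (QW b w == r)%:R - q^-1
    = \sum_xi q ^+ k * salie r b (QW_dual b xi) / (#|{: W k}|%:R * q)
        * psi (dotW xi w).
Proof.
move=> two0 b0 w; set N : algC := #|{: W k}|%:R.
have q0 : q != 0 by rewrite pnatr_eq0 -lt0n (ltn_trans _ (finNzRing_gt1 F)).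
have N0 : N != 0 by rewrite pnatr_eq0 -lt0n; apply/card_gt0P; exists w.
pose M (u : W k) : algC := (QW b u == r)%:R - q^-1.
(* The subtracted [q^-1] is exactly the [t = 0] term of the character expansion of the indicator. *)
have qM u : q * M u = \sum_(t | t != 0) psi (t * (QW b u - r)).
  rewrite sum_neq0 mul0r psi0; under eq_bigr do rewrite mulrC.
  by rewrite sum_psiM subr_eq0 mulrBr mulfV // mulr_natr.
have hat xi :
    \sum_u q * M u * psi (- dotW xi u) = q ^+ k * salie r b (QW_dual b xi).
  rewrite /salie mulr_sumr.
  under eq_bigr do rewrite qM mulr_suml.
  rewrite exchange_big /=; apply: eq_bigr => t t0; rewrite -sum_psi_QW //.
  by apply: eq_bigr => u _; rewrite psiD.
rewrite -/(M w); apply: (mulfI (mulf_neq0 N0 q0)); rewrite mulr_sumr.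
(* Fourier inversion: the inner sum is [N] at [u = w] and 0 elsewhere. *)
transitivity (\sum_u q * M u * \sum_xi psi (dotW xi (w - u))).
  rewrite (bigD1 w) //= subrr sum_psi_dotW eqxx big1 => [|u uw].
    by rewrite addr0 -mulrA mulrC.
  by rewrite sum_psi_dotW subr_eq0 eq_sym (negPf uw) mulr0n mulr0.
under eq_bigr do rewrite mulr_sumr.
rewrite exchange_big /=; apply: eq_bigr => xi _.
rewrite -hat mulrA [_ * (_ / _)]mulrC divfK ?mulf_neq0 // mulr_suml.
apply: eq_bigr => u _; rewrite dotWD dotWN psiD; ring.
Qed.

Lemma norm_sphere_discrepancy nu k (b r : F) (I J : finType)
    (P : {set I}) (S : {set J}) (f : I -> W k) (g : J -> W k) :
  odd #|F| -> (forall a : F, a ^+ 2 != nu) -> b != 0 ->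
  {in P &, injective f} -> {in S &, injective g} ->
  `|\sum_(i in P) \sum_(j in S) ((QW b (f i - g j) == r)%:R - q^-1)| ^+ 2
    <= (2%:R * q ^+ k) ^+ 2 * #|P|%:R * #|S|%:R.
Proof.
move=> q_odd nonsq b0 inj_f inj_g.
have kernelE (w : W k) := sphere_kernel_fourier r (two_neq0 q_odd) b0 w.
have q_gt0 : 0 < q by rewrite ltr0n (ltn_trans _ (finNzRing_gt1 F)).
have N_gt0 : 0 < #|{: W k}|%:R :> algC.
  by rewrite ltr0n; apply/card_gt0P; exists 0.
(* The Salie bound [2 q] cancels the [q] in the denominator of the Fourier coefficients. *)
pose B : algC := 2%:R * q ^+ k / #|{: W k}|%:R.
have <- : B * #|{: W k}|%:R = 2%:R * q ^+ k by rewrite divfK ?gt_eqF.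
apply: (norm_difference_kernel_sum (M := fun v => (QW b v == r)%:R - q^-1) _
          (@sum_psi_dotW k) kernelE) => //.
- by move=> xi x y; rewrite dotWD dotWN psiD psiN.
- by rewrite divr_ge0 ?mulr_ge0 ?exprn_ge0 ?ler0n.
move=> xi; rewrite !normrM normfV normrX !normrM !normr_nat /B.
rewrite ler_pdivrMr ?mulr_gt0 // mulrA divfK ?gt_eqF // mulrAC mulrC -mulrA.
by rewrite mulrA ler_wpM2r ?exprn_ge0 ?ler0n // (norm_salie _ _ q_odd nonsq).
Qed.

End AdditiveCharacter.

(** * Passage from row vectors to split coordinates *)

Section Coordinates.
Variables (F : finFieldType) (d : nat).
Implicit Types x y : 'rV[F]_d.

Definition split_coords x : {ffun 'I_d./2 -> F * F} * F :=
  ([ffun j : 'I_d./2 => (coord x j.*2, coord x j.*2.+1)], coord x d.-1).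

Lemma coordB k x y : coord (x - y) k = coord x k - coord y k.
Proof. by rewrite /coord; case: insub => [j|]; rewrite ?mxE ?subr0. Qed.

Lemma split_coordsB x y :
  split_coords (x - y) = split_coords x - split_coords y.
Proof.
congr (_, _); last exact: coordB.
by apply/ffunP=> j; rewrite !ffunE !coordB.
Qed.

(** For odd [d] the last index is [d./2.*2], just after the pairs, so no coordinate is missed. *)
Lemma split_coords_inj : odd d -> injective split_coords.
Proof.
move=> d_odd x y [/ffunP eq_xy eq_last]; apply/rowP=> i.
have coordE (z : 'rV[F]_d) : z 0 i = coord z i by rewrite /coord valK.
have def_d : d.-1 = d./2.*2 by rewrite -{1}(odd_double_half d) d_odd.
rewrite !coordE.
have [lt_i|ge_i] := ltnP i d./2.*2; last first.
  suff -> : nat_of_ord i = d.-1 by [].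
  apply/eqP; rewrite eqn_leq {2}def_d ge_i andbT.
  by rewrite -ltnS prednK ?ltn_ord ?odd_gt0.
have lt_i2 : (i./2 < d./2)%N.
  rewrite -ltn_double (leq_ltn_trans _ lt_i) //.
  by rewrite -{2}(odd_double_half i) leq_addl.
have := eq_xy (Ordinal lt_i2); rewrite !ffunE => -[eq0 eq1].
by rewrite -(odd_double_half i); case: (odd i).
Qed.

Lemma Q3E x : Q3 x = QW 1 (split_coords x).
Proof.
by rewrite /Q3 /QW /hyperbolic_part mul1r; congr (_ - _);
  apply: eq_bigr => j _; rewrite ffunE.
Qed.

Lemma Q4E eps x : Q4 eps x = QW eps (split_coords x).
Proof.
by congr (_ - _); apply: eq_bigr => j _; rewrite ffunE.
Qed.

Lemma incidencesE (Q : 'rV[F]_d -> F) P S :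
  incidences Q P S
  = (\sum_(x in P) \sum_(s in S) (Q (x - center s)%R == radius s))%N.
Proof.
rewrite pair_big_dep /= /incidences -sum1_card big_mkcond [RHS]big_mkcond /=.
apply: eq_bigr => -[x s] _; rewrite !inE /=.
by case: (x \in P); case: (s \in S) => //=; case: (_ == _).
Qed.

End Coordinates.

(* Squared and multiplied by q ^ 2, the bound proved in [algC] is a statement on
   integers, which transfers to any real closed field. *)
Lemma sphere_incidence_bound (F : finFieldType) (nu b r : F) (d : nat)
    (Q : 'rV[F]_d -> F) (P : {set 'rV[F]_d}) (S : {set sphere F d}) :
  odd #|F| -> (forall a : F, a ^+ 2 != nu) -> odd d -> b != 0 ->
  Q =1 (fun x => QW b (split_coords x)) -> {in S, forall s, radius s = r} ->
  ((#|F| * incidences Q P S)%:Z - (#|P| * #|S|)%:Z) ^+ 2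
    <= (4 * #|F| ^ (d./2.*2.+2) * #|P| * #|S|)%:Z.
Proof.
move=> q_odd nonsq d_odd b0 QE Sr.
have [psi [psiD norm_psi nontriv]] := exists_nontrivial_additive_char F.
have inj_f : {in P &, injective (@split_coords F d)}.
  by move=> x y _ _; apply: split_coords_inj.
(* A common radius makes a sphere of [S] determined by its center. *)
have inj_g :
    {in S &, injective (fun s : sphere F d => split_coords (center s))}.
  move=> [x s] [y t] /Sr/= + /Sr/= + /(split_coords_inj d_odd)/= eq_xy.
  by rewrite /radius /= => -> ->; congr (_, _).
have := norm_sphere_discrepancy psiD norm_psi nontriv r q_odd nonsq b0
          inj_f inj_g.
have q0 : #|F|%:R != 0 :> algC.
  by rewrite pnatr_eq0 -lt0n (ltn_trans _ (finNzRing_gt1 F)).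
have -> : \sum_(x in P) \sum_(s in S)
     ((QW b (split_coords x - split_coords (center s)) == r)%:R - #|F|%:R^-1)
   = ((#|F| * incidences Q P S)%:Z - (#|P| * #|S|)%:Z)%:~R / #|F|%:R :> algC.
  apply: (mulIf q0); rewrite divfK // incidencesE rmorphB /= -!pmulrn !natrM.
  under eq_bigr do rewrite sumrB sumr_const.
  rewrite sumrB sumr_const mulrBl mulrC; congr (_ - _).
    congr (_ * _); rewrite natr_sum; apply: eq_bigr => x _.
    rewrite natr_sum; apply: eq_bigr => s Ss.
    by rewrite QE split_coordsB (Sr s Ss).
  by rewrite -mulrnA -[_ *+ (_ * _)]mulr_natr mulrAC mulVf // mul1r mulnC natrM.
rewrite normrM exprMn normfV normr_nat exprVn ler_pdivrMr; last first.
  by rewrite exprn_gt0 // lt_def q0 ler0n.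
rewrite real_normK ?realz // -rmorphXn -(ler_int algC) -pmulrn /=.
move/le_trans; apply; rewrite (natrM _ _ #|S|) (natrM _ _ #|P|) natrM natrX.
rewrite -(addn2 d./2.*2) exprD -muln2 exprM le_eqVlt; apply/orP; left.
by apply/eqP; ring.
Qed.

(** * The strict bound on the maximal discrepancy *)

Theorem theorem4p3 (R : rcfType) (F : finFieldType) (hq : odd #|F|)
    (eps : F) (heps : forall a : F, a ^+ 2 != eps)
    (d : nat) (hd : odd d) (i : nat) (hi : i = 3%N \/ i = 4%N)
    (n m : nat) (hn : (0 < n)%N) (hm : (0 < m)%N) (r : F) (hr : r != 0) :
  max_discrepancy R (@Qform F d eps i) r n m
    < 3%:R * #|F|%:R ^+ (d.-1)./2 * Num.sqrt m%:R * Num.sqrt n%:R.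
Proof.
have q_gt0 : (0 < #|F|)%N by rewrite (ltn_trans _ (finNzRing_gt1 F)).
have -> : (d.-1)./2 = d./2 by rewrite -{1}(odd_double_half d) hd /= doubleK.
(* Needed also because the unit 0 of the maximum must lie strictly below the bound. *)
have bound_gt0 :
    0 < 3%:R * #|F|%:R ^+ d./2 * Num.sqrt m%:R * Num.sqrt n%:R :> R.
  by rewrite !mulr_gt0 ?exprn_gt0 ?sqrtr_gt0 ?ltr0n.
apply: bigmax_lt => // P /eqP card_P.
apply: bigmax_lt => // S /andP[/eqP card_S] /'forall_implyP rad_S.
have Sr : {in S, forall s, radius s = r} by move=> s /rad_S/eqP.
have [b b0 QE] : exists2 b : F, b != 0
    & Qform eps i =1 (fun x : 'rV[F]_d => QW b (split_coords x)).
  case: hi => ->; first by exists 1; [exact: oner_neq0 | exact: Q3E].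
  by exists eps; [have := heps 0; rewrite expr0n eq_sym | exact: Q4E].
have := sphere_incidence_bound P hq heps hd b0 QE Sr.
have q0 : #|F|%:R != 0 :> R by rewrite pnatr_eq0 -lt0n.
rewrite -(ler_int R) rmorphXn rmorphB /= -!pmulrn (natrM _ #|P| #|S|).
rewrite (natrM _ _ #|S|) (natrM _ _ #|P|) (natrM _ 4) natrX natrM card_P card_S.
have -> : #|F|%:R * (incidences (Qform eps i) P S)%:R - n%:R * m%:R
    = #|F|%:R * ((incidences (Qform eps i) P S)%:R
                 - #|F|%:R^-1 * n%:R * m%:R) :> R.
  by field.
set D := _%:R - _ * _ * _.
move=> leD; rewrite -(ltr_pXn2r (_ : 0 < 2)%N) ?nnegrE ?(ltW bound_gt0) //.
rewrite real_normK ?num_real //.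
rewrite -(ltr_pM2l (_ : 0 < #|F|%:R ^+ 2)) ?exprn_gt0 ?ltr0n // -exprMn.
apply: le_lt_trans leD _.
rewrite !exprMn !sqr_sqrtr ?ler0n // -(addn2 d./2.*2) exprD -muln2 exprM.
set X := _ ^+ 2; set Y := _ ^+ 2.
(* The constant 2 is what has been proved; strictness comes from [4 < 9] and the positivity of [n]
   and [m]. *)
have -> : Y * (3%:R ^+ 2 * X * m%:R * n%:R) = 9%:R * (X * Y * n%:R * m%:R).
  by ring.
have -> : 4%:R * (X * Y) * n%:R * m%:R = 4%:R * (X * Y * n%:R * m%:R) by ring.
by rewrite ltr_pM2r ?ltr_nat // !mulr_gt0 ?exprn_gt0 ?ltr0n.
Qed.
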